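(* For every positive integer $N>1$, \[ \mathfrak{C}_2(N) = K(2N)^5 + O(N^4\log N), \qquad \text{where } K = \frac{10\zeta(2)}{3\zeta(3)}, \] and the implied constant is absolute.
   Context: For positive integers $d,N$, let $\mathrm{Mat}_d(\mathbb{Z},N)$ denote the set of $d\times d$ matrices with all entries in $[-N,N]\cap\mathbb{Z}$, and let $\mathfrak{C}_d(N)$ be the number of pairs $(A,B)\in \mathrm{Mat}_d(\mathbb{Z},N)^2$ with $AB=BA$. Here $\zeta$ is the Riemann zeta function. *)

(* Defs.v *)
From HB Require Import structures.
From mathcomp Require Import all_boot all_order all_algebra.
From Stdlib Require Import Reals.
From Coquelicot Require Import Coquelicot.

Set Implicit Arguments. Unset Strict Implicit. Unset Printing Implicit Defensive.
Import GRing.Theory.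

(* Entry encoding: i : 'I_(2N+1) represents the integer i - N, a bijection
   onto [-N, N] ∩ Z. *)
Definition ent (N : nat) (i : 'I_(2 * N + 1)) : int := GRing.add (Posz i) (GRing.opp (Posz N)).

Definition mat_of (d N : nat) (A : 'M['I_(2 * N + 1)]_d) : 'M[int]_d :=
  map_mx (@ent N) A.

Definition Cfrak (d N : nat) : nat :=
  #|[set p : 'M['I_(2 * N + 1)]_d * 'M['I_(2 * N + 1)]_d |
      mulmx (mat_of p.1) (mat_of p.2) == mulmx (mat_of p.2) (mat_of p.1)]|.

Definition zeta (s : nat) : R := Series (fun k => / (INR (k + 1)) ^ s).

Definition Kconst : R := (10 * zeta 2 / (3 * zeta 3))%R.

(* Main.v *)
(** Matrices [a b; c d] and [e f; g h] commute iff the vectors u = (b, c, a - d)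
    and v = (f, g, e - h) are parallel. When both are nonzero there are unique
    coprime k, l >= 1 and a unique sign with l u = +-k v. Write n = 2N + 1. The
    pairs with u = 0 or v = 0 number 2 n^5 - n^2. For m = max(k, l) and
    j = min(k, l), the pairs with ratio k : l and given sign number
      (2 floor(N/m) + 1)^2 * sum_t (n - m|t|)^+ (n - j|t|)^+ - n^2,
    and comparing the sum over t with the integral over [-n/m, n/m] turns this
    into n^5/m^3 (1 - j/(3m)) + O(n^4/m^2). Summing over coprime pairs with
    m <= 2N, where the coprime j < m average to m/2, the main terms add up to
    (10/3) n^5 sum_m phi(m)/m^3 and the errors to O(n^4 sum_m 1/m) =
    O(N^4 log N). Finally sum_m phi(m)/m^3 = zeta(2)/zeta(3), because
    m^(-2) is the Dirichlet convolution of phi(d)/d^3 and e^(-3). *)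

From mathcomp Require all_boot all_order all_algebra zify ring lra cyclic Rstruct.
From Coquelicot Require Coquelicot.
Require Import Defs.
From Stdlib Require Import Reals.

Module CommutingMatrices.

Import all_boot all_order all_algebra zify ring lra cyclic Rstruct.
Import Coquelicot.Rcomplements Coquelicot.Rbar Coquelicot.Hierarchy.
Import Coquelicot.Lim_seq Coquelicot.Series.
Import Order.TTheory GRing.Theory Num.Theory.
Set Implicit Arguments. Unset Strict Implicit. Unset Printing Implicit Defensive.
Local Open Scope ring_scope.

(** * Commuting matrices and parallel vectors *)

Section Parallel.

Variables (R : comNzRingType) (d : nat).
Implicit Types u v : 'rV[R]_d.

Definition parallel u v : bool := [forall i, forall j, u 0 i * v 0 j == u 0 j * v 0 i].

Lemma parallelP u v : reflect (forall i j, u 0 i * v 0 j = u 0 j * v 0 i) (parallel u v).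
Proof.
apply: (iffP forallP) => [uv i j|uv i]; last by apply/forallP => j; apply/eqP.
exact/eqP/(forallP (uv i)).
Qed.

Lemma parallel0v v : parallel 0 v.
Proof. by apply/parallelP => i j; rewrite !mxE !mul0r. Qed.

Lemma parallelC u v : parallel u v = parallel v u.
Proof. by apply/parallelP/parallelP => uv i j; rewrite mulrC uv mulrC. Qed.

Lemma parallelvN u v : parallel u (- v) = parallel u v.
Proof.
by apply/parallelP/parallelP => uv i j; have := uv i j; rewrite !mxE !mulrN;
  [exact: oppr_inj|move->].
Qed.

End Parallel.

Lemma ord3_cases (i : 'I_3) : [\/ i = 0, i = 1 | i = 2].
Proof.
by case: i => [[|[|[|//]]] ?]; [constructor 1|constructor 2|constructor 3]; apply: val_inj.
Qed.

Lemma forall_ord3 (P : pred 'I_3) : [forall i, P i] = [&& P 0, P 1 & P 2].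
Proof.
apply/forallP/and3P => [P3|[P0 P1 P2] i]; first by split.
by case: (ord3_cases i) => ->.
Qed.

Lemma parallel3E (R : comNzRingType) (u v : 'rV[R]_3) :
  parallel u v = [&& u 0 0 * v 0 1 == u 0 1 * v 0 0, u 0 0 * v 0 2 == u 0 2 * v 0 0
                   & u 0 1 * v 0 2 == u 0 2 * v 0 1].
Proof.
apply/parallelP/and3P => [uv|[/eqP uv01 /eqP uv02 /eqP uv12] i j].
  by split; apply/eqP.
by case: (ord3_cases i) => ->; case: (ord3_cases j) => ->.
Qed.

Lemma matrix2P (T : Type) (A B : 'M[T]_2) :
  A 0 0 = B 0 0 -> A 0 1 = B 0 1 -> A 1 0 = B 1 0 -> A 1 1 = B 1 1 -> A = B.
Proof.
have ord2 (i : 'I_2) : i = 0 \/ i = 1.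
  by case: i => [[|[|//]] ?]; [left|right]; apply: val_inj.
by move=> A00 A01 A10 A11; apply/matrixP => i j; case: (ord2 i) (ord2 j) => -> [] ->.
Qed.

Definition offscalar (R : pzRingType) (A : 'M[R]_2) : 'rV[R]_3 :=
  \row_j [:: A 0 1; A 1 0; A 0 0 - A 1 1]`_j.

Lemma mulmx2_commE (R : comNzRingType) (A B : 'M[R]_2) :
  (A *m B == B *m A) = parallel (offscalar A) (offscalar B).
Proof.
have mulE (C D : 'M[R]_2) i j : (C *m D) i j = C i 0 * D 0 j + C i 1 * D 1 j.
  rewrite mxE !big_ord_recl big_ord0 addr0.
  by rewrite (_ : lift ord0 ord0 = 1); last exact: val_inj.
set u := offscalar A; set v := offscalar B; set K := A *m B - B *m A.
have KE i j : K i j = (A *m B) i j - (B *m A) i j by rewrite mxE [X in _ + X]mxE.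
have K00 : K 0 0 = u 0 0 * v 0 1 - u 0 1 * v 0 0.
  by rewrite KE !mulE !mxE /=; ring.
have K01 : K 0 1 = - (u 0 0 * v 0 2 - u 0 2 * v 0 0).
  by rewrite KE !mulE !mxE /=; ring.
have K10 : K 1 0 = u 0 1 * v 0 2 - u 0 2 * v 0 1.
  by rewrite KE !mulE !mxE /=; ring.
have K11 : K 1 1 = - (u 0 0 * v 0 1 - u 0 1 * v 0 0).
  by rewrite KE !mulE !mxE /=; ring.
rewrite -subr_eq0 -/K parallel3E; apply/eqP/and3P => [K0|[/eqP uv01 /eqP uv02 /eqP uv12]].
  split; rewrite -subr_eq0; [|rewrite -oppr_eq0|].
  - by rewrite -K00 K0 mxE.
  - by rewrite -K01 K0 mxE.
  - by rewrite -K10 K0 mxE.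
apply: matrix2P; rewrite [RHS]mxE.
- by rewrite K00 uv01 subrr.
- by rewrite K01 uv02 subrr oppr0.
- by rewrite K10 uv12 subrr.
- by rewrite K11 uv01 subrr oppr0.
Qed.

(** * Coprime ratios of parallel integer vectors *)

Definition proportional (V : zmodType) (k l : nat) (u v : V) : bool := u *+ l == v *+ k.

Lemma proportional_intE (k l : nat) (a b : int) :
  proportional k l a b = (l%:Z * a == k%:Z * b).
Proof. by rewrite /proportional -(mulr_natl a) -(mulr_natl b) !natz. Qed.

Lemma proportional_absz (k l : nat) (a b : int) :
  proportional k l a b || proportional k l a (- b) = (l * `|a| == k * `|b|)%N.
Proof.
rewrite !proportional_intE; apply/orP/eqP => [[] /eqP|]; [nia|nia|].
by have [|neq] := eqVneq (l%:Z * a) (k%:Z * b); [left|right; apply/eqP; nia].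
Qed.

Lemma coprime_ratio_unique (k l k' l' a b : nat) : (0 < a)%N -> (0 < k)%N ->
  coprime k l -> coprime k' l' -> (l * a = k * b)%N -> (l' * a = k' * b)%N ->
  (k, l) = (k', l').
Proof.
move=> a0 k0 kl kl' la l'a.
have cross : (l * k' = l' * k)%N.
  by apply/eqP; rewrite -(eqn_pmul2r a0); apply/eqP; nia.
have kk' : k = k'.
  apply/eqP; rewrite eqn_dvd -(Gauss_dvdr _ kl) cross dvdn_mull //=.
  by rewrite -(Gauss_dvdr _ kl') -cross dvdn_mull.
by congr pair => //; apply/eqP; rewrite -(eqn_pmul2r k0) -cross kk'.
Qed.

Section ProportionalVectors.

Variable d : nat.
Implicit Types u v : 'rV[int]_d.

Lemma proportional_rowE (k l : nat) u v :
  proportional k l u v = [forall i, proportional k l (u 0 i) (v 0 i)].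
Proof.
apply/eqP/forallP => [uv i|uv]; first by rewrite /proportional -!mulmxnE uv.
by apply/rowP => i; rewrite !mulmxnE; apply/eqP; exact: uv.
Qed.

Lemma proportional_eq0 (k l : nat) u v : (0 < k)%N -> (0 < l)%N ->
  proportional k l u v -> (u == 0) = (v == 0).
Proof.
have mulrn_row_eq0 (m : nat) w : (0 < m)%N -> (w *+ m == 0 :> 'rV[int]_d) = (w == 0).
  move=> m0; apply/eqP/eqP => [/rowP wm|->]; last by rewrite mul0rn.
  by apply/rowP => i; move/eqP: (wm i); rewrite mulmxnE mxE mulrn_eq0 eqn0Ngt m0 => /eqP.
by move=> k0 l0 /eqP uv; rewrite -(mulrn_row_eq0 l) // uv mulrn_row_eq0.
Qed.

Lemma proportional_parallel (k l : nat) u v : (0 < l)%N ->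
  proportional k l u v -> parallel u v.
Proof.
move=> l0; rewrite proportional_rowE => /forallP uv; apply/parallelP => i j.
have := uv i; have := uv j; rewrite !proportional_intE => /eqP uvj /eqP uvi.
have lN0 : l%:Z != 0 by lia.
by apply: (mulfI lN0); rewrite !mulrA uvi uvj; ring.
Qed.

Lemma parallel_proportional (k l : nat) u v (i : 'I_d) :
  u 0 i != 0 -> parallel u v -> proportional k l (u 0 i) (v 0 i) -> proportional k l u v.
Proof.
move=> ui /parallelP uv; rewrite proportional_intE proportional_rowE => /eqP uvi.
apply/forallP => j; rewrite proportional_intE; apply/eqP/(mulfI ui).
by rewrite mulrCA mulrA uvi mulrCA [in RHS]uv; ring.
Qed.

Lemma parallel_coprime_proportional (M : nat) u v : u != 0 -> v != 0 -> parallel u v ->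
  (forall i, `|u 0%R i| <= M)%N -> (forall i, `|v 0%R i| <= M)%N ->
  exists k l, [/\ (0 < k <= M)%N, (0 < l <= M)%N, coprime k l
    & proportional k l u v || proportional k l u (- v)].
Proof.
move=> /rV0Pn[i ui] /rV0Pn[j vj] uv uM vM.
have vi : v 0 i != 0.
  apply/eqP => vi; move/parallelP: uv => /(_ i j) /eqP.
  by rewrite vi mulr0 mulf_eq0 (negPf ui) (negPf vj).
have aM := uM i; have bM := vM i.
set a := u 0 i in ui aM *; set b := v 0 i in vi bM *.
have g0 : (0 < gcdn `|a| `|b|)%N by rewrite gcdn_gt0; lia.
have [k ka] := dvdnP (dvdn_gcdl `|a| `|b|); have [l lb] := dvdnP (dvdn_gcdr `|a| `|b|).
exists k, l; split; [nia|nia| |].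
  by rewrite /coprime -(eqn_pmul2r g0) muln_gcdl -ka -lb mul1n.
have : proportional k l a b || proportional k l a (- b).
  by rewrite proportional_absz; apply/eqP; nia.
case/orP => ab; apply/orP; [left|right]; apply: (parallel_proportional ui) => //.
  by rewrite parallelvN.
by rewrite mxE.
Qed.

Lemma proportional_unique (k l k' l' : nat) u v :
  u != 0 -> (0 < k)%N -> coprime k l -> coprime k' l' ->
  proportional k l u v || proportional k l u (- v) ->
  proportional k' l' u v || proportional k' l' u (- v) -> (k, l) = (k', l').
Proof.
move=> /rV0Pn[i ui] k0 kl kl'.
have entryE m p : proportional m p u v || proportional m p u (- v) ->
    (p * `|u 0%R i| = m * `|v 0%R i|)%N.
  rewrite !proportional_rowE => uv; apply/eqP; rewrite -proportional_absz.
  by case/orP: uv => /forallP /(_ i); rewrite ?mxE => ->; rewrite ?orbT.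
move=> /entryE uv /entryE uv'.
by apply: (coprime_ratio_unique _ k0 kl kl' uv uv'); rewrite absz_gt0.
Qed.

Lemma proportionalN_excl (k l : nat) u v : u != 0 -> (0 < l)%N ->
  proportional k l u v -> ~~ proportional k l u (- v).
Proof.
move=> /rV0Pn[i ui] l0; rewrite !proportional_rowE => /forallP /(_ i) uv.
apply/forallP => /(_ i); move: uv; rewrite mxE !proportional_intE mulrN => /eqP uv.
rewrite -uv -subr_eq0 opprK -mulr2n mulrn_eq0 mulf_eq0 (negPf ui) orbF /=; lia.
Qed.

End ProportionalVectors.

Lemma big_nat_only1 (R : Type) (idx : R) (op : Monoid.com_law idx) (m n k : nat)
    (P : pred nat) (F : nat -> R) : (m <= k < n)%N -> P k ->
  (forall i, (m <= i < n)%N -> P i -> i != k -> F i = idx) ->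
  \big[op/idx]_(m <= i < n | P i) F i = F k.
Proof.
move=> mkn Pk F0; rewrite big_mkcond (bigD1_seq k) ?mem_index_iota ?iota_uniq //= Pk.
rewrite big1_seq ?Monoid.mulm1 // => i /andP[ik]; rewrite mem_index_iota => imn.
by case: ifP => // Pi; exact: F0.
Qed.

Lemma parallel_eq_sum_proportional (d M : nat) (u v : 'rV[int]_d) : u != 0 -> v != 0 ->
  (forall i, `|u 0%R i| <= M)%N -> (forall i, `|v 0%R i| <= M)%N ->
  parallel u v = (\sum_(1 <= k < M.+1) \sum_(1 <= l < M.+1 | coprime k l)
    (proportional k l u v + proportional k l u (- v)))%N :> nat.
Proof.
move=> u0 v0 uM vM; have [uv|nuv] := boolP (parallel u v); last first.
  rewrite big_nat big1 // => k _; rewrite big_nat_cond big1 // => l /andP[/andP[l0 _] _].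
  have nprop w : ~~ parallel u w -> proportional k l u w = false.
    by move=> nuw; apply: contraNF nuw; exact: proportional_parallel.
  by rewrite !nprop ?parallelvN.
have [k [l [kM lM kl ratio]]] := parallel_coprime_proportional u0 v0 uv uM vM.
have other_ratio0 k' l' : (0 < k')%N -> coprime k' l' -> (k', l') != (k, l) ->
    (proportional k' l' u v + proportional k' l' u (- v) = 0)%N.
  move=> k'0 kl' ne; apply/eqP; rewrite addn_eq0 !eqb0 -negb_or; apply: contra ne => ratio'.
  by apply/eqP/(proportional_unique u0 k'0 kl' kl ratio').
rewrite (@big_nat_only1 _ _ _ _ _ k) // => [|k' k'M _ k'k]; last first.
  rewrite big_nat_cond big1 // => l' /andP[_ kl']; apply: other_ratio0 => //; first by lia.
  by apply: contra k'k => /eqP[->].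
rewrite (@big_nat_only1 _ _ _ _ _ l) // => [|l' l'M kl' l'l]; last first.
  by apply: other_ratio0 => //; [lia|apply: contra l'l => /eqP[->]].
case/andP: lM => l0 _; case/orP: ratio => uvk; have := proportionalN_excl u0 l0 uvk.
  by rewrite uvk => /negPf->.
by rewrite opprK uvk => /negPf->.
Qed.

Lemma sum_nat_pred (T : finType) (P Q : pred T) :
  (\sum_(x | P x) Q x = #|[set x | P x && Q x]|)%N.
Proof.
by rewrite -sum1dep_card [RHS]big_mkcondr; apply: eq_bigr => x _; case: (Q x).
Qed.

Lemma card_pairs_meeting (T : finType) (Z : {set T}) :
  (#|[set p : T * T | (p.1 \in Z) || (p.2 \in Z)]| + #|Z| ^ 2 = 2 * (#|Z| * #|T|))%N.
Proof.
have -> : [set p : T * T | (p.1 \in Z) || (p.2 \in Z)] = setX Z setT :|: setX setT Z.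
  by apply/setP => p; rewrite !inE andbT.
have ZZ : setX Z setT :&: setX setT Z = setX Z Z by apply/setP => p; rewrite !inE andbT.
by rewrite -mulnn -cardsX -ZZ cardsUI !cardsX cardsT [(#|T| * _)%N]mulnC addnn mul2n.
Qed.

Section CountParallel.

Variables (T : finType) (d M : nat) (f : T -> 'rV[int]_d) (opp : T -> T).
Hypothesis f_bound : forall x i, (`|f x 0%R i| <= M)%N.
Hypothesis opp_inj : injective opp.
Hypothesis f_opp : forall x, f (opp x) = - f x.

Definition zeros : {set T} := [set x | f x == 0].

Definition proportional_pairs (k l : nat) : {set T * T} :=
  [set p | proportional k l (f p.1) (f p.2)].

Definition nonzero_proportional_pairs (k l : nat) : {set T * T} :=
  [set p in proportional_pairs k l | f p.1 != 0].

Lemma card_nonzero_proportional_pairs (k l : nat) : (0 < k)%N -> (0 < l)%N ->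
  (#|nonzero_proportional_pairs k l| + #|zeros| ^ 2 = #|proportional_pairs k l|)%N.
Proof.
move=> k0 l0; rewrite addnC -mulnn -cardsX -[RHS](cardsID (setX zeros zeros)).
congr (_ + _)%N; apply: eq_card => -[x y]; rewrite !inE /=.
  apply/andP/andP => [[/eqP-> /eqP->]|[_ /andP//]].
  by rewrite /proportional !mul0rn !eqxx.
rewrite andbC; case: (boolP (proportional _ _ _ _)) => [xy|]; last by rewrite !andbF.
by rewrite (proportional_eq0 k0 l0 xy) andbb.
Qed.

Lemma card_nonzero_antiproportional_pairs (k l : nat) :
  #|[set p | (f p.1 != 0) && proportional k l (f p.1) (- f p.2)]| =
  #|nonzero_proportional_pairs k l|.
Proof.
pose opp2 (p : T * T) := (p.1, opp p.2).
have opp2_inj : injective opp2 by move=> [x y] [x' y'] [-> /opp_inj ->].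
rewrite -[RHS](on_card_preimset (f := opp2)); last exact/onW_bij/injF_bij.
by apply: eq_card => p; rewrite !inE /= f_opp andbC.
Qed.

Lemma card_parallel_pairs :
  (#|[set p : T * T | parallel (f p.1) (f p.2)]| + #|zeros| ^ 2 =
   2 * (#|zeros| * #|T|) + 2 * \sum_(1 <= k < M.+1) \sum_(1 <= l < M.+1 | coprime k l)
     #|nonzero_proportional_pairs k l|)%N.
Proof.
pose U := [set p : T * T | (p.1 \in zeros) || (p.2 \in zeros)].
rewrite -card_pairs_meeting -/U -(cardsID U) addnAC; congr (_ + _ + _)%N.
  apply: eq_card => p; rewrite !inE andbC; case: eqP => [->|_] /=; first by rewrite parallel0v.
  by case: eqP => [->|_] //=; rewrite parallelC parallel0v.
rewrite (_ : _ :\: U = [set p | (p \notin U) && parallel (f p.1) (f p.2)]); last first.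
  by apply/setP => p; rewrite !inE.
rewrite -sum_nat_pred big_distrr /=.
under eq_bigr => p pU.
  rewrite (@parallel_eq_sum_proportional _ M) //; [over| |];
    by move: pU; rewrite !inE negb_or => /andP[].
rewrite exchange_big /= big_nat [RHS]big_nat; apply: eq_bigr => k /andP[k0 _].
rewrite exchange_big /= big_distrr /= big_nat_cond [RHS]big_nat_cond.
apply: eq_bigr => l /andP[/andP[l0 _] _]; rewrite big_split /= !sum_nat_pred mul2n -addnn.
rewrite -{2}card_nonzero_antiproportional_pairs.
congr (_ + _)%N; apply: eq_card => p; rewrite !inE negb_or;
  case: (boolP (proportional _ _ _ _)) => [xy|_]; rewrite ?andbF // !andbT.
  by rewrite -(proportional_eq0 k0 l0 xy) andbb.
by rewrite -(oppr_eq0 (f p.2)) -(proportional_eq0 k0 l0 xy) andbb.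
Qed.

End CountParallel.

(** * Counting in the box *)

Lemma ent_inj (N : nat) : injective (@ent N).
Proof. by move=> x y /addIr [] /val_inj. Qed.

Lemma ent_surj (N : nat) (z : int) : (`|z| <= N)%N -> exists x : 'I_(2 * N + 1), ent x = z.
Proof.
move=> zN; have lt : (`|(z + N%:Z)%R| < 2 * N + 1)%N by lia.
by exists (Ordinal lt); rewrite /ent /=; lia.
Qed.

Lemma ent_rev_ord (N : nat) (x : 'I_(2 * N + 1)) : ent (rev_ord x) = - ent x.
Proof. by rewrite /ent /=; have := ltn_ord x; lia. Qed.

Lemma absz_ent_le (N : nat) (x : 'I_(2 * N + 1)) : (`|ent x| <= N)%N.
Proof. by rewrite /ent; have := ltn_ord x; lia. Qed.

Lemma absz_ent_sub_le (N : nat) (x y : 'I_(2 * N + 1)) : (`|(ent x - ent y)%R| <= 2 * N)%N.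
Proof. by rewrite /ent; have := ltn_ord x; have := ltn_ord y; lia. Qed.

Lemma card_ent (N : nat) (z : int) :
  #|[set x : 'I_(2 * N + 1) | ent x == z]| = (`|z| <= N)%N.
Proof.
case: (boolP (`|z| <= N)%N) => [/ent_surj[x <-]|zN].
  rewrite (_ : finset _ = [set x]) ?cards1 //.
  by apply/setP => y; rewrite !inE (inj_eq (@ent_inj N)).
apply/eqP; rewrite cards_eq0 -subset0; apply/subsetP => x; rewrite !inE => /eqP xz.
by rewrite -xz absz_ent_le in zN.
Qed.

Lemma card_ent_sub (N : nat) (z : int) :
  #|[set p : 'I_(2 * N + 1) * 'I_(2 * N + 1) | ent p.1 - ent p.2 == z]| = (2 * N + 1 - `|z|)%N.
Proof.
wlog z0 : z / 0 <= z => [nonneg|].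
  have [/nonneg//|zlt0] := lerP 0 z.
  rewrite -[z in RHS]opprK abszN -nonneg; last by lia.
  rewrite -[LHS](on_card_preimset (f := fun p => (p.2, p.1))); last first.
    by apply/onW_bij; exists (fun p => (p.2, p.1)) => -[].
  by apply: eq_card => p; rewrite !inE /= -eqr_opp opprB.
case: z z0 => // t _; rewrite absz_nat -(sum_nat_pred predT).
rewrite -(pair_bigA _ (fun x y => nat_of_bool (ent x - ent y == t%:Z))) /= exchange_big /=.
have <- : (\sum_(y < 2 * N + 1 - t) 1 = 2 * N + 1 - t)%N by rewrite sum1_card card_ord.
rewrite (big_ord_widen (2 * N + 1) (fun=> 1%N)) ?leq_subr // [RHS]big_mkcond.
apply: eq_bigr => y _; case: ltnP => ty.
  have lt : (y + t < 2 * N + 1)%N by lia.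
  rewrite (@big_only1 _ _ _ _ (Ordinal lt)) //= => [|x xy _].
    by rewrite /ent /=; apply/eqP; rewrite eqb1; apply/eqP; lia.
  apply/eqP; rewrite eqb0; apply: contra xy => /eqP; rewrite /ent => xy.
  by apply/eqP/val_inj => /=; lia.
by rewrite big1 // => x _; apply/eqP; rewrite eqb0 /ent; have := ltn_ord x; lia.
Qed.

Lemma sum_absz_ent (N : nat) (F : nat -> nat) :
  (\sum_(x < 2 * N + 1) F `|ent x| = F 0 + 2 * \sum_(1 <= t < N.+1) F t)%N.
Proof.
pose G i := F `|(i%:Z - N%:Z)%R|%N; rewrite -(big_mkord xpredT G).
have below : (\sum_(0 <= i < N) G i = \sum_(1 <= t < N.+1) F t)%N.
  rewrite big_nat_rev big_add1 /= big_nat [RHS]big_nat; apply: eq_bigr => i iN.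
  by congr F; lia.
have above : (\sum_(N.+1 <= i < 2 * N + 1) G i = \sum_(1 <= t < N.+1) F t)%N.
  rewrite -[N.+1 in LHS]add0n big_addn big_add1 (_ : 2 * N + 1 - N.+1 = N)%N; last by lia.
  by rewrite big_nat [RHS]big_nat; apply: eq_bigr => i iN; congr F; lia.
rewrite (@big_cat_nat _ _ _ N) //=; last by lia.
rewrite [X in (_ + X)%N]big_ltn ?below ?above; last by lia.
by rewrite {1}/G subrr /=; lia.
Qed.

(* For coprime k and l, [l a = k b] means [(a, b) = (k t, l t)] for a unique t. *)
Lemma coprime_proportional_eq_sum (M k l : nat) (a b : int) :
  (0 < k)%N -> coprime k l -> (`|a| <= M)%N ->
  proportional k l a b =
    (\sum_(t < 2 * M + 1) ((a == k%:Z * ent t)%R && (b == l%:Z * ent t)%R))%N :> nat.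
Proof.
move=> k0 kl aM; have [ab|nab] := boolP (proportional k l a b); last first.
  rewrite big1 // => t _; apply/eqP; rewrite eqb0; apply: contra nab => /andP[/eqP-> /eqP->].
  by rewrite proportional_intE mulrCA.
move: ab; rewrite proportional_intE => /eqP ab.
have kN0 : k%:Z != 0 by lia.
have /divzK ka : (k %| a)%Z by rewrite -(@Gauss_dvdzr k l) // ab dvdz_mulr.
set q := (a %/ k)%Z in ka; have qM : (`|q| <= M)%N by nia.
have [t tq] := ent_surj qM; rewrite (@big_only1 _ _ _ _ t) //=.
  rewrite tq mulrC ka eqxx /=; apply/esym/eqP; rewrite eqb1; apply/eqP/(mulfI kN0).
  by rewrite -ab -ka; ring.
move=> s st _; apply/eqP; rewrite eqb0 -ka -tq; apply: contra st => /andP[/eqP + _].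
by rewrite mulrC => /(mulfI kN0)/ent_inj ->.
Qed.

Lemma card_coprime_proportional (A B : finType) (alpha : A -> int) (beta : B -> int)
    (M k l : nat) : (0 < k)%N -> coprime k l -> (forall x, `|alpha x| <= M)%N ->
  (#|[set p : A * B | proportional k l (alpha p.1) (beta p.2)]| =
   \sum_(t < 2 * M + 1)
     #|[set x | alpha x == (k%:Z * ent t)%R]| * #|[set y | beta y == (l%:Z * ent t)%R]|)%N.
Proof.
move=> k0 kl alphaM; rewrite -(sum_nat_pred predT).
under eq_bigr => p _ do rewrite (@coprime_proportional_eq_sum M) //.
rewrite exchange_big /=; apply: eq_bigr => t _.
by rewrite -cardsX sum_nat_pred; apply: eq_card => p; rewrite !inE.
Qed.

Lemma card_componentwise_pairs (S T U : finType) (P : pred (S * S)) (Q : pred (T * T))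
    (R : pred (U * U)) :
  (#|[set p : (S * T * U) * (S * T * U) |
      [&& P (p.1.1.1, p.2.1.1), Q (p.1.1.2, p.2.1.2) & R (p.1.2, p.2.2)]]| =
   #|[set p | P p]| * #|[set p | Q p]| * #|[set p | R p]|)%N.
Proof.
pose h (q : (S * S) * (T * T) * (U * U)) :=
  ((q.1.1.1, q.1.2.1, q.2.1), (q.1.1.2, q.1.2.2, q.2.2)).
have h_bij : bijective h.
  exists (fun p => ((p.1.1.1, p.2.1.1), (p.1.1.2, p.2.1.2), (p.1.2, p.2.2))).
    by move=> [[[? ?] [? ?]] [? ?]].
  by move=> [[[? ?] ?] [[? ?] ?]].
rewrite -[LHS](on_card_preimset (onW_bij _ h_bij)) -!cardsX.
by apply: eq_card => -[[[? ?] [? ?]] [? ?]]; rewrite !inE /= andbA.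
Qed.

(* [q = ((b, c), (a, d))] encodes the matrix [a b; c d], so that the components
   of [offscalar] depend on separate components of [q]. *)
Definition mx2_of (T : Type) (q : T * T * (T * T)) : 'M[T]_2 :=
  \matrix_(i, j) if i == j then (if i == 0 then q.2.1 else q.2.2)
                 else (if i == 0 then q.1.1 else q.1.2).

Lemma mx2_of_bij (T : Type) : bijective (@mx2_of T).
Proof.
exists (fun A : 'M[T]_2 => ((A 0 1, A 1 0), (A 0 0, A 1 1))).
  by move=> [[b c] [a d]]; rewrite !mxE.
by move=> A; apply: matrix2P; rewrite mxE.
Qed.

Definition difference_pairs (n k l : nat) : nat :=
  (n ^ 2 + 2 * \sum_(1 <= t < n) (n - k * t) * (n - l * t))%N.

Definition ratio_pairs (N k l : nat) : nat :=
  ((1 + 2 * (N %/ maxn k l)) ^ 2 * difference_pairs (2 * N + 1) k l)%N.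

Lemma ratio_pairsC (N k l : nat) : ratio_pairs N k l = ratio_pairs N l k.
Proof.
rewrite /ratio_pairs maxnC /difference_pairs; congr (_ * (_ + 2 * _))%N.
by apply: eq_bigr => t _; rewrite mulnC.
Qed.

Section Box.

Variable N : nat.
Local Notation n := (2 * N + 1)%N.

Lemma card_proportional_ent (k l : nat) : (0 < k)%N -> coprime k l ->
  #|[set p : 'I_n * 'I_n | proportional k l (ent p.1) (ent p.2)]| =
  (1 + 2 * (N %/ maxn k l))%N.
Proof.
move=> k0 kl; rewrite (@card_coprime_proportional _ _ _ _ N) //; last exact: absz_ent_le.
under eq_bigr do rewrite !card_ent !abszM !absz_nat.
rewrite (sum_absz_ent N (fun t => ((k * t <= N)%N * (l * t <= N)%N)%N)) !muln0 /=.
congr (_ + 2 * _)%N; set q := (N %/ maxn k l)%N.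
have qN : (q <= N)%N by exact: leq_div.
have <- : (\sum_(1 <= t < q.+1) 1 = q)%N by rewrite sum_nat_const_nat muln1 subn1.
rewrite [in RHS](big_nat_widen _ _ N.+1) // [in RHS]big_mkcond; apply: eq_bigr => t _.
rewrite /= mulnb ltnS leq_divRL ?leq_max ?k0 // maxnMr geq_max ![(t * _)%N]mulnC.
by case: andP.
Qed.

Lemma card_proportional_ent_sub (k l : nat) : (0 < k)%N -> coprime k l ->
  #|[set p : ('I_n * 'I_n) * ('I_n * 'I_n) |
     proportional k l (ent p.1.1 - ent p.1.2) (ent p.2.1 - ent p.2.2)]| =
  difference_pairs n k l.
Proof.
move=> k0 kl; pose delta (x : 'I_n * 'I_n) : int := ent x.1 - ent x.2.
rewrite (@card_coprime_proportional _ _ delta delta (2 * N)) // => [|x]; last first.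
  exact: absz_ent_sub_le.
under eq_bigr do rewrite !card_ent_sub !abszM !absz_nat.
rewrite (sum_absz_ent (2 * N) (fun t => ((n - k * t) * (n - l * t))%N)).
by rewrite !muln0 subn0 mulnn -[(2 * N).+1]addn1.
Qed.

Definition box_offscalar (A : 'M['I_n]_2) : 'rV[int]_3 := offscalar (mat_of A).

Lemma box_offscalar_mx2_of (q : 'I_n * 'I_n * ('I_n * 'I_n)) :
  box_offscalar (mx2_of q) =
  \row_j [:: ent q.1.1; ent q.1.2; ent q.2.1 - ent q.2.2]`_j.
Proof. by rewrite /box_offscalar /offscalar !mxE. Qed.

Lemma box_offscalar_rev (A : 'M['I_n]_2) :
  box_offscalar (map_mx (@rev_ord n) A) = - box_offscalar A.
Proof. by apply/rowP => -[[|[|[|//]]] ?]; rewrite !mxE !ent_rev_ord /= -?opprD. Qed.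

Lemma absz_box_offscalar_le (A : 'M['I_n]_2) (i : 'I_3) :
  (`|box_offscalar A 0%R i| <= 2 * N)%N.
Proof.
have ent_le x : (`|@ent N x| <= 2 * N)%N by rewrite (leq_trans (absz_ent_le x)) // leq_pmull.
by case: i => [[|[|[|//]]] ?]; rewrite !mxE //=; exact: absz_ent_sub_le.
Qed.

Lemma card_zeros_box_offscalar : #|zeros box_offscalar| = n.
Proof.
rewrite -(on_card_preimset (onW_bij _ (@mx2_of_bij 'I_n))).
transitivity #|setX (setX [set x : 'I_n | ent x == 0] [set x : 'I_n | ent x == 0])
                    [set p : 'I_n * 'I_n | ent p.1 - ent p.2 == 0]|; last first.
  by rewrite !cardsX !card_ent card_ent_sub /=; lia.
apply: eq_card => q; rewrite !inE box_offscalar_mx2_of.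
apply/eqP/andP => [/rowP q0|[/andP[/eqP b0 /eqP c0] /eqP ad0]].
  by have := (q0 0, q0 1, q0 2); rewrite !mxE /= => -[[-> ->] ->].
by apply/rowP => -[[|[|[|//]]] ?]; rewrite !mxE.
Qed.

Lemma card_proportional_pairs_box_offscalar (k l : nat) : (0 < k)%N -> coprime k l ->
  #|proportional_pairs box_offscalar k l| = ratio_pairs N k l.
Proof.
move=> k0 kl; pose h (q : _ * _) := (@mx2_of 'I_n q.1, @mx2_of 'I_n q.2).
have h_bij : bijective h.
  have [g gK Kg] := @mx2_of_bij 'I_n; exists (fun p => (g p.1, g p.2)).
    by move=> [x y]; rewrite /= !gK.
  by move=> [x y]; rewrite /h !Kg.
rewrite /ratio_pairs -(on_card_preimset (onW_bij _ h_bij)) -mulnn.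
rewrite -{1}(card_proportional_ent k0 kl) -(card_proportional_ent k0 kl).
rewrite -(card_proportional_ent_sub k0 kl) -card_componentwise_pairs.
apply: eq_card => -[q r]; rewrite !inE /= proportional_rowE.
by rewrite !box_offscalar_mx2_of forall_ord3 !mxE.
Qed.

Lemma Cfrak2E :
  (Cfrak 2 N + n ^ 2 = 2 * n ^ 5 + 2 * \sum_(1 <= k < n) \sum_(1 <= l < n | coprime k l)
     #|nonzero_proportional_pairs box_offscalar k l|)%N.
Proof.
have rev_inj : injective (map_mx (@rev_ord n) : 'M['I_n]_2 -> 'M_2).
  by apply: inv_inj => A; apply/matrixP => i j; rewrite !mxE rev_ordK.
have := card_parallel_pairs absz_box_offscalar_le rev_inj box_offscalar_rev.
rewrite card_zeros_box_offscalar card_mx card_ord -expnS -[(2 * N).+1]addn1 => <-.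
by congr (_ + _)%N; apply: eq_card => p; rewrite !inE mulmx2_commE.
Qed.

End Box.

(** * The number of pairs of a given ratio *)

Section RatioEstimates.

Variable F : realFieldType.

(* [G] plays the role of an antiderivative of the antitone function [g]. *)
Lemma sum_antitone_bounds (g G : F -> F) (L : nat) (x : F) :
  L%:R <= x -> x <= L.+1%:R -> (forall t, 0 <= t <= x -> 0 <= g t) ->
  (forall s t, 0 <= s -> s <= t -> t <= x ->
    (t - s) * g t <= G t - G s <= (t - s) * g s) ->
  \sum_(1 <= t < L.+1) g t%:R <= G x - G 0 <= \sum_(0 <= t < L.+1) g t%:R.
Proof.
move=> Lx xL g0 Gg.
have step_bounds t : (t < L)%N -> g t.+1%:R <= G t.+1%:R - G t%:R <= g t%:R.
  move=> tL; have := Gg t%:R t.+1%:R; rewrite -natrB // subSnn !mul1r ler_nat; apply => //.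
  by rewrite (le_trans _ Lx) ?ler_nat.
have /andP[last_ge last_le] := Gg L%:R x (ler0n _ _) Lx (lexx _).
have xg0 : 0 <= (x - L%:R) * g x.
  by rewrite mulr_ge0 ?subr_ge0 // g0 ?lexx ?andbT ?(le_trans _ Lx).
have xgL : (x - L%:R) * g L%:R <= g L%:R.
  by rewrite ler_piMl ?g0 ?Lx ?ler0n // lerBlDr nat1r.
have -> : G x - G 0 = \sum_(0 <= t < L) (G t.+1%:R - G t%:R) + (G x - G L%:R).
  by rewrite (telescope_sumr (fun t => G t%:R)) // [RHS]addrC subrKA.
apply/andP; split.
  rewrite big_add1 -[leLHS]addr0 lerD ?(le_trans xg0) //.
  by apply: ler_sum_nat => t /andP[_ /step_bounds/andP[]].
rewrite big_nat_recr //= lerD ?(le_trans last_le) //.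
by apply: ler_sum_nat => t /andP[_ /step_bounds/andP[]].
Qed.

Definition tent_product (n m j t : F) : F := (n - m * t) * (n - j * t).

Definition tent_primitive (n m j t : F) : F :=
  n ^+ 2 * t - n * (m + j) * t ^+ 2 / 2 + m * j * t ^+ 3 / 3.

Lemma tent_primitive_bounds (n m j s t : F) :
  0 <= n -> 0 <= j -> j <= m -> m * s <= n -> m * t <= n ->
  (t - s) * tent_product n m j t <= tent_primitive n m j t - tent_primitive n m j s
    <= (t - s) * tent_product n m j s.
Proof.
move=> n0 j0 jm msn mtn.
have msj : m * j * s <= n * j by rewrite mulrAC ler_wpM2r.
have mtj : m * j * t <= n * j by rewrite mulrAC ler_wpM2r.
have njm : n * j <= n * m by rewrite ler_wpM2l.
rewrite -subr_ge0 -[X in _ && X]subr_ge0; apply/andP; split.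
  rewrite (_ : _ - _ = (t - s) ^+ 2 * (n * (m + j) / 2 - (m * j * s + 2 * (m * j * t)) / 3)).
    by rewrite mulr_ge0 ?sqr_ge0 //; lra.
  by rewrite /tent_primitive /tent_product; field.
rewrite (_ : _ - _ = (t - s) ^+ 2 * (n * (m + j) / 2 - (2 * (m * j * s) + m * j * t) / 3)).
  by rewrite mulr_ge0 ?sqr_ge0 //; lra.
by rewrite /tent_primitive /tent_product; field.
Qed.

Lemma natr_sum_tent_product (n m j L : nat) : (L < n)%N -> (j <= m)%N ->
  (m * L <= n)%N -> (n <= m * L.+1)%N ->
  (\sum_(1 <= t < n) (n - m * t) * (n - j * t))%:R =
  \sum_(1 <= t < L.+1) tent_product n%:R m%:R j%:R t%:R.
Proof.
move=> Ln jm mL nmL; rewrite (@big_cat_nat _ _ _ L.+1) //=.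
rewrite [X in (_ + X)%N]big_nat [X in (_ + X)%N]big1 => [|t tL]; last first.
  by rewrite (_ : n - m * t = 0)%N //; nia.
rewrite addn0 natr_sum big_nat [RHS]big_nat; apply: eq_bigr => t tL.
by rewrite /tent_product natrM !natrB ?natrM //; nia.
Qed.

Lemma difference_pairs_estimate (n m j : nat) : (0 < n)%N -> (0 < m)%N -> (j <= m)%N ->
  `|(difference_pairs n m j)%:R - n%:R ^+ 3 / m%:R * (1 - j%:R / (3 * m%:R))|
    <= n%:R ^+ 2 :> F.
Proof.
move=> n0 m0 jm; set L := (n.-1 %/ m)%N.
have Ln : (L < n)%N by rewrite (leq_ltn_trans (leq_div _ _)) ?prednK.
have mL : (m * L < n)%N by have := leq_divM n.-1 m; rewrite -/L mulnC; lia.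
have nmL : (n <= m * L.+1)%N by have := @ltn_ceil n.-1 m m0; rewrite -/L mulnC; lia.
have mF : 0 < m%:R :> F by rewrite ltr0n.
have jmF : j%:R <= m%:R :> F by rewrite ler_nat.
pose g := tent_product n%:R m%:R j%:R; pose G := tent_primitive n%:R m%:R j%:R.
have x_le t : (t <= n%:R / m%:R) = (m%:R * t <= n%:R :> F) by rewrite ler_pdivlMr // mulrC.
have integralE : n%:R ^+ 3 / m%:R * (1 - j%:R / (3 * m%:R)) = 2 * (G (n%:R / m%:R) - G 0).
  by rewrite /G /tent_primitive; field; lra.
have Lx : L%:R <= n%:R / m%:R :> F by rewrite x_le -natrM ler_nat ltnW.
have xL : n%:R / m%:R <= L.+1%:R :> F by rewrite ler_pdivrMr // mulrC -natrM ler_nat.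
have g_ge0 t : 0 <= t <= n%:R / m%:R -> 0 <= g t.
  rewrite x_le => /andP[t0 tn]; rewrite mulr_ge0 ?subr_ge0 //.
  by rewrite (le_trans _ tn) // ler_wpM2r.
have G_bounds s t : 0 <= s -> s <= t -> t <= n%:R / m%:R ->
    (t - s) * g t <= G t - G s <= (t - s) * g s.
  move=> _ st; rewrite x_le => tn; apply: tent_primitive_bounds; rewrite ?ler0n //.
  by rewrite (le_trans _ tn) // ler_wpM2l // ltW.
have g0 : g 0 = n%:R ^+ 2 by rewrite /g /tent_product; ring.
have := sum_antitone_bounds Lx xL g_ge0 G_bounds.
rewrite [\sum_(0 <= t < L.+1) _]big_ltn //= g0 /difference_pairs natrD natrM natrX.
by rewrite (natr_sum_tent_product Ln jm (ltnW mL) nmL) integralE ler_norml; lra.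
Qed.

Lemma square_mul_estimate (c x n D T : F) : 1 <= x -> 0 <= c -> `|c - x| <= 1 ->
  0 <= T <= n ^+ 2 * x -> `|D - T| <= n ^+ 2 ->
  `|c ^+ 2 * D - n ^+ 2 - x ^+ 2 * T| <= 8 * n ^+ 2 * x ^+ 2.
Proof.
move=> x1 c0 cx /andP[T0 Tx] DT.
have n2 := sqr_ge0 n; have c2x : c <= 2 * x by move: cx; rewrite ler_norml; lra.
have -> : c ^+ 2 * D - n ^+ 2 - x ^+ 2 * T =
    c ^+ 2 * (D - T) + (c - x) * (c + x) * T - n ^+ 2 by ring.
have square_part : `|c ^+ 2 * (D - T)| <= 4 * x ^+ 2 * n ^+ 2.
  rewrite normrM ger0_norm ?sqr_ge0 // ler_pM ?sqr_ge0 //.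
  by rewrite (_ : 4 * x ^+ 2 = (2 * x) ^+ 2) ?ler_sqr ?nnegrE //; [lra|ring].
have cross_part : `|(c - x) * (c + x) * T| <= 1 * (3 * x) * (n ^+ 2 * x).
  by rewrite !normrM !ler_pM ?mulr_ge0 ?(ger0_norm T0) // ger0_norm; lra.
have n2x2 : n ^+ 2 <= n ^+ 2 * x ^+ 2 by rewrite ler_peMr // exprn_ege1.
rewrite (le_trans (ler_normB _ _)) // (ger0_norm n2).
rewrite (le_trans (lerD (ler_normD _ _) n2x2)) //; lra.
Qed.

Lemma odd_multiples_estimate (N m : nat) : (0 < m)%N ->
  `|(1 + 2 * (N %/ m))%:R - (2 * N + 1)%:R / m%:R| <= 1 :> F.
Proof.
move=> m0; set q := (N %/ m)%N; have mF : 0 < m%:R :> F by rewrite ltr0n.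
have mq : (m * q <= N)%N by rewrite mulnC leq_divM.
have Nmq : (N < m * q.+1)%N by rewrite mulnC ltn_ceil.
rewrite (_ : _ - _ = ((m * (1 + 2 * q))%:R - (2 * N + 1)%:R) / m%:R); last first.
  by rewrite natrM; field; lra.
rewrite normrM normfV (gtr0_norm mF) ler_pdivrMr // mul1r ler_distl lerBlDr -!natrD !ler_nat.
by apply/andP; split; nia.
Qed.

Definition ratio_main (n m j : F) : F := n ^+ 5 / m ^+ 3 * (1 - j / (3 * m)).

Lemma ratio_pairs_estimate (N m j : nat) (n := (2 * N + 1)%N) :
  (0 < m)%N -> (j <= m)%N -> (m < n)%N ->
  `|(ratio_pairs N m j)%:R - n%:R ^+ 2 - ratio_main n%:R m%:R j%:R| <=
    8 * n%:R ^+ 4 * m%:R ^- 2.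
Proof.
move=> m0 jm mn; have n0 : (0 < n)%N by rewrite /n addn1.
have mF : 0 < m%:R :> F by rewrite ltr0n.
pose x : F := n%:R / m%:R; pose y : F := 1 - j%:R / m%:R / 3.
have -> : ratio_main n%:R m%:R j%:R = x ^+ 2 * (n%:R ^+ 3 / m%:R * (1 - j%:R / (3 * m%:R))).
  by rewrite /ratio_main /x; field; lra.
have -> : 8 * n%:R ^+ 4 * m%:R ^- 2 = 8 * n%:R ^+ 2 * x ^+ 2 by rewrite /x; field; lra.
have x1 : 1 <= x by rewrite ler_pdivlMr // mul1r ler_nat ltnW.
rewrite /ratio_pairs (maxn_idPl jm) natrM natrX; apply: square_mul_estimate => //.
- exact: odd_multiples_estimate.
- rewrite (_ : _ / _ * _ = n%:R ^+ 2 * (x * y)); last by rewrite /x /y; field; lra.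
  have jm0 : 0 <= j%:R / m%:R :> F by rewrite divr_ge0.
  have jm1 : j%:R / m%:R <= 1 :> F by rewrite ler_pdivrMr // mul1r ler_nat.
  have x0 : 0 <= x := le_trans ler01 x1.
  have y0 : 0 <= y by rewrite /y; lra.
  have y1 : y <= 1 by rewrite /y; lra.
  apply/andP; split; first by rewrite mulr_ge0 ?sqr_ge0 // mulr_ge0.
  by rewrite ler_wpM2l ?sqr_ge0 // ler_piMr.
- exact: difference_pairs_estimate.
Qed.

End RatioEstimates.

(** * Summing over coprime ratios *)

Lemma sum_nat_symmetric (V : nmodType) (a b : nat) (g : nat -> nat -> V) :
  (forall k l, g k l = g l k) ->
  \sum_(a <= k < b) \sum_(a <= l < b) g k l =
  \sum_(a <= k < b) (g k k + (\sum_(a <= l < k) g k l) *+ 2).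
Proof.
move=> gC; have [ba|/ltnW ab] := leqP b a; first by rewrite !big_geq.
rewrite -(subnKC ab); elim: (b - a)%N => [|d IH]; first by rewrite addn0 !big_geq.
have le_ad : (a <= a + d)%N by exact: leq_addr.
rewrite addnS !(@big_nat_recr _ _ _ (a + d)) //= -IH.
under eq_bigr do rewrite big_nat_recr //=.
rewrite big_split /= (eq_bigr (g (a + d)%N) (fun k _ => gC k (a + d)%N)) -addrA.
by rewrite [X in _ + X = _]addrA -mulr2n [X in _ + X = _]addrC.
Qed.

Lemma sum_coprime_symmetric (V : nmodType) (n : nat) (g : nat -> nat -> V) : (1 < n)%N ->
  (forall k l, g k l = g l k) ->
  \sum_(1 <= k < n) \sum_(1 <= l < n | coprime k l) g k l =
  g 1%N 1%N + (\sum_(2 <= m < n) \sum_(1 <= j < m | coprime m j) g m j) *+ 2.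
Proof.
move=> n1 gC; pose h k l := if coprime k l then g k l else 0.
under eq_bigr do rewrite big_mkcond; rewrite /=.
rewrite (@sum_nat_symmetric V 1 n h) => [|k l]; last by rewrite /h coprime_sym gC.
rewrite [LHS]big_ltn //= [\sum_(1 <= l < 1) _]big_geq // mul0rn addr0; congr (_ + _).
rewrite -sumrMnl big_nat [RHS]big_nat; apply: eq_bigr => m /andP[m1 _].
by rewrite /h /coprime gcdnn gtn_eqF // add0r -big_mkcond.
Qed.

Lemma sum_coprime_const (V : nmodType) (m : nat) (x : V) : (1 < m)%N ->
  \sum_(1 <= j < m | coprime m j) x = x *+ totient m.
Proof.
move=> m1; rewrite totient_count_coprime big_ltn; last exact: ltnW.
rewrite /coprime gcdn0 gtn_eqF // add0n -sumrMnr big_mkcond /=.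
by apply: eq_bigr => j _; case: (_ == _).
Qed.

Lemma coprime_subr (m j : nat) : (j <= m)%N -> coprime m (m - j) = coprime m j.
Proof.
move=> /subnKC <-; rewrite addKn /coprime [in LHS]gcdnC gcdnDr.
by rewrite [in RHS]gcdnC gcdnDl gcdnC.
Qed.

Lemma sum_coprime_id (m : nat) : (1 < m)%N ->
  (2 * \sum_(1 <= j < m | coprime m j) j = m * totient m)%N.
Proof.
move=> m1; rewrite mul2n -addnn {1}big_nat_rev /= big_nat_cond [X in (_ + X)%N]big_nat_cond.
rewrite (eq_bigl (fun j => (1 <= j < m)%N && coprime m j)) => [|j]; last first.
  by case: (boolP (0 < j < m)%N) => //= /andP[j0 jm]; rewrite add1n subSS coprime_subr // ltnW.
rewrite -big_split /= (eq_bigr (fun=> m)) => [|j /andP[/andP[j0 jm] _]]; last first.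
  by rewrite add1n subSS subnK // ltnW.
by rewrite -big_nat_cond sum_coprime_const // -mulr_natr natn.
Qed.

Lemma totient_leq (m : nat) : (totient m <= m)%N.
Proof. by rewrite -{2}(sum_totient_dvd m) (bigD1 ord_max) //= leq_addr. Qed.

Definition totient_ratio (F : fieldType) (s m : nat) : F := (totient m)%:R / m%:R ^+ s.

Section CoprimeSums.

Variable F : realFieldType.

Lemma sum_coprime_ratio_main (n : F) (m : nat) : (1 < m)%N ->
  \sum_(1 <= j < m | coprime m j) ratio_main n m%:R j%:R =
  5 / 6 * n ^+ 5 * totient_ratio F 3 m.
Proof.
move=> m1; have mF : m%:R != 0 :> F by rewrite pnatr_eq0 gtn_eqF // ltnW.
have sum_id : \sum_(1 <= j < m | coprime m j) (j%:R : F) = m%:R * (totient m)%:R / 2.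
  by rewrite -natr_sum -natrM -(sum_coprime_id m1) natrM mulrC mulKf // pnatr_eq0.
rewrite /ratio_main -mulr_sumr sumrB sum_coprime_const // -mulr_suml sum_id.
by rewrite /totient_ratio; field.
Qed.

Lemma sum_coprime_inv_maxn_sqr_le (n : nat) : (1 < n)%N ->
  \sum_(1 <= k < n) \sum_(1 <= l < n | coprime k l) (maxn k l)%:R ^- 2 <=
  2 * \sum_(1 <= m < n) m%:R^-1 :> F.
Proof.
move=> n1; rewrite sum_coprime_symmetric // => [|k l]; last by rewrite maxnC.
rewrite [in leRHS]big_ltn // maxnn expr1n invr1 mulrDr mulr1 lerD ?ler1n //.
rewrite mulr_natl -!sumrMnl; apply: ler_sum_nat => m /andP[m1 _].
have mF : 0 < m%:R :> F by rewrite ltr0n ltnW.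
rewrite (_ : \sum_(_ <= _ < _ | _) _ = m%:R ^- 2 *+ totient m); last first.
  rewrite -sum_coprime_const // big_nat_cond [RHS]big_nat_cond.
  by apply: eq_bigr => j /andP[/andP[_ /ltnW jm] _]; rewrite (maxn_idPl jm).
rewrite lerMn2r /= -[leLHS]mulr_natr exprS expr1 invfM -mulrA ler_piMr ?invr_ge0 ?(ltW mF) //.
by rewrite mulrC ler_pdivrMr // mul1r ler_nat totient_leq.
Qed.

Variable N : nat.
Local Notation n := (2 * N + 1)%N.

Definition pair_main (k l : nat) : F := ratio_main n%:R (maxn k l)%:R (minn k l)%:R.

Definition pair_error (k l : nat) : F := (ratio_pairs N k l)%:R - n%:R ^+ 2 - pair_main k l.

Lemma pair_mainC (k l : nat) : pair_main k l = pair_main l k.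
Proof. by rewrite /pair_main maxnC minnC. Qed.

(* The [- 1] comes from the ratio 1 : 1; it cancels the [2 n^5] pairs with a zero vector. *)
Lemma sum_pair_main : (0 < N)%N ->
  \sum_(1 <= k < n) \sum_(1 <= l < n | coprime k l) pair_main k l =
  n%:R ^+ 5 * (5 / 3 * \sum_(1 <= m < n) totient_ratio F 3 m - 1).
Proof.
move=> N0; have n1 : (1 < n)%N by lia.
rewrite sum_coprime_symmetric //; last exact: pair_mainC.
have -> : pair_main 1 1 = 2 / 3 * n%:R ^+ 5 by rewrite /pair_main /ratio_main maxnn minnn; field.
have -> : \sum_(2 <= m < n) \sum_(1 <= j < m | coprime m j) pair_main m j =
    5 / 6 * n%:R ^+ 5 * \sum_(2 <= m < n) totient_ratio F 3 m.
  rewrite mulr_sumr big_nat [RHS]big_nat; apply: eq_bigr => m /andP[m1 _].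
  rewrite -sum_coprime_ratio_main // big_nat_cond [RHS]big_nat_cond.
  apply: eq_bigr => j /andP[/andP[_ /ltnW jm] _].
  by rewrite /pair_main (maxn_idPl jm) (minn_idPr jm).
have totient_ratio1 : totient_ratio F 3 1 = 1 by rewrite /totient_ratio expr1n invr1 mulr1.
by rewrite [in RHS]big_ltn // totient_ratio1; field.
Qed.

Lemma pair_error_le (k l : nat) : (0 < k < n)%N -> (0 < l < n)%N ->
  `|pair_error k l| <= 8 * n%:R ^+ 4 * (maxn k l)%:R ^- 2.
Proof.
wlog lk : k l / (l <= k)%N => [le_case kn ln|/andP[k0 kn] _].
  case/orP: (leq_total l k) => [lk|kl]; first exact: le_case.
  by rewrite /pair_error ratio_pairsC pair_mainC maxnC; exact: le_case.
rewrite /pair_error /pair_main (maxn_idPl lk) (minn_idPr lk).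
exact: ratio_pairs_estimate.
Qed.

Lemma sum_pair_error_le : (0 < N)%N ->
  `|\sum_(1 <= k < n) \sum_(1 <= l < n | coprime k l) pair_error k l| <=
  16 * n%:R ^+ 4 * \sum_(1 <= m < n) m%:R^-1.
Proof.
move=> N0; have n1 : (1 < n)%N by lia.
pose S : F := \sum_(1 <= k < n) \sum_(1 <= l < n | coprime k l) (maxn k l)%:R ^- 2.
apply: (@le_trans _ _ (8 * n%:R ^+ 4 * S)).
  rewrite mulr_sumr (le_trans (ler_norm_sum _ _ _)) //.
  apply: ler_sum_nat => k kn; rewrite mulr_sumr (le_trans (ler_norm_sum _ _ _)) //.
  rewrite big_nat_cond [leRHS]big_nat_cond; apply: ler_sum => l /andP[ln _].
  exact: pair_error_le.
rewrite (_ : 16 * n%:R ^+ 4 = 8 * n%:R ^+ 4 * 2); last by ring.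
by rewrite -[leRHS]mulrA ler_wpM2l ?sum_coprime_inv_maxn_sqr_le // mulr_ge0 // exprn_ge0.
Qed.

Lemma Cfrak2_main_plus_error : (0 < N)%N ->
  (Cfrak 2 N)%:R = 10 / 3 * (\sum_(1 <= m < n) totient_ratio F 3 m) * n%:R ^+ 5 - n%:R ^+ 2 +
    2 * \sum_(1 <= k < n) \sum_(1 <= l < n | coprime k l) pair_error k l.
Proof.
move=> N0.
have card_main_plus_error k l : (0 < k)%N -> (0 < l)%N -> coprime k l ->
    #|nonzero_proportional_pairs (@box_offscalar N) k l|%:R = pair_main k l + pair_error k l.
  move=> k0 l0 kl; rewrite /pair_error addrC subrK.
  rewrite -card_proportional_pairs_box_offscalar // -card_nonzero_proportional_pairs //.
  by rewrite card_zeros_box_offscalar natrD natrX addrK.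
have := congr1 (fun c => c%:R : F) (Cfrak2E N).
rewrite (natrD _ (Cfrak 2 N)) (natrD _ (2 * n ^ 5)%N) !(natrM _ 2) !natrX natr_sum.
rewrite (eq_big_nat _ _ (F2 := fun k => \sum_(1 <= l < n | coprime k l) pair_main k l +
  \sum_(1 <= l < n | coprime k l) pair_error k l)) => [|k /andP[k0 _]]; last first.
  rewrite natr_sum -big_split /= big_nat_cond [RHS]big_nat_cond.
  by apply: eq_bigr => l /andP[/andP[l0 _] kl]; exact: card_main_plus_error.
by rewrite big_split /= sum_pair_main //; lra.
Qed.

Lemma Cfrak2_estimate : (0 < N)%N ->
  `|(Cfrak 2 N)%:R - 10 / 3 * (\sum_(1 <= m < n) totient_ratio F 3 m) * n%:R ^+ 5| <=
  33 * n%:R ^+ 4 * \sum_(1 <= m < n) m%:R^-1.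
Proof.
move=> N0; have n24 : n%:R ^+ 2 <= n%:R ^+ 4 * \sum_(1 <= m < n) (m%:R^-1 : F).
  rewrite -[leLHS]mulr1 ler_pM ?exprn_ge0 ?ler0n //; first by rewrite ler_weXn2l ?ler1n ?addn1.
  rewrite big_ltn; last by lia.
  by rewrite invr1 lerDl sumr_ge0 // => m _; rewrite invr_ge0.
have n2 : 0 <= n%:R ^+ 2 :> F by exact: sqr_ge0.
by have := sum_pair_error_le N0; rewrite Cfrak2_main_plus_error // !ler_norml; lra.
Qed.

End CoprimeSums.

(** * Dirichlet convolutions and zeta values *)

Lemma big_nat_multiples (R : Type) (idx : R) (op : Monoid.law idx) (d X : nat) (F : nat -> R) :
  (0 < d)%N ->
  \big[op/idx]_(1 <= m < X.+1 | (d %| m)%N) F m =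
  \big[op/idx]_(1 <= e < (X %/ d).+1) F (d * e)%N.
Proof.
move=> d0; elim: X => [|X IH]; first by rewrite div0n !big_geq.
rewrite big_mkcond big_nat_recr // -big_mkcond IH divnS //=.
case: (boolP (d %| X.+1)%N) => dX /=; last by rewrite add0n Monoid.mulm1.
rewrite add1n [RHS]big_nat_recr //=; congr (op _ (F _)).
by move: (divnS X d0) (divnK dX); rewrite dX mulnC => ->.
Qed.

Definition Dirichlet_conv (R : pzSemiRingType) (f g : nat -> R) (m : nat) : R :=
  \sum_(1 <= d < m.+1 | (d %| m)%N) f d * g (m %/ d)%N.

Lemma sum_Dirichlet_conv (R : pzSemiRingType) (f g : nat -> R) (X : nat) :
  \sum_(1 <= m < X.+1) Dirichlet_conv f g m =
  \sum_(1 <= d < X.+1) f d * \sum_(1 <= e < (X %/ d).+1) g e.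
Proof.
transitivity (\sum_(1 <= m < X.+1) \sum_(1 <= d < X.+1 | (d %| m)%N) f d * g (m %/ d)%N).
  rewrite big_nat [RHS]big_nat; apply: eq_bigr => m /andP[m0 mX].
  rewrite /Dirichlet_conv [RHS](@big_cat_nat _ _ _ m.+1) //= [X in _ = _ + X]big_nat_cond.
  rewrite [X in _ = _ + X]big1 ?addr0 // => d /andP[/andP[md _] dm].
  by have := dvdn_leq m0 dm; rewrite leqNgt md.
under eq_bigr do rewrite big_mkcond; rewrite /=.
rewrite exchange_big /= big_nat [RHS]big_nat; apply: eq_bigr => d /andP[d0 _].
rewrite -big_mkcond big_nat_multiples // mulr_sumr; apply: eq_bigr => e _.
by rewrite mulKn.
Qed.

Lemma sum_inv_sqr_le (F : realFieldType) (a b : nat) : (0 < a <= b)%N ->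
  \sum_(a.+1 <= m < b.+1) m%:R ^- 2 <= a%:R^-1 - b%:R^-1 :> F.
Proof.
move=> /andP[a0 ab]; rewrite big_add1 /=.
rewrite -opprB -(telescope_sumr (fun m => m%:R^-1)) // -sumrN.
apply: ler_sum_nat => m /andP[am _]; have m0 : 0 < m%:R :> F by rewrite ltr0n (leq_trans a0).
rewrite opprB -natr1 -subr_ge0.
rewrite (_ : _ - _ = (m%:R * (m%:R + 1) ^+ 2)^-1); last by field; lra.
by rewrite invr_ge0; apply: mulr_ge0; [exact: ltW|exact: sqr_ge0].
Qed.

Lemma inv_exp_le_inv_sqr (F : realFieldType) (s m : nat) : (2 <= s)%N -> (0 < m)%N ->
  m%:R ^- s <= m%:R ^- 2 :> F.
Proof.
by move=> s2 m0; rewrite lef_pV2 ?posrE ?exprn_gt0 ?ltr0n // ler_weXn2l ?ler1n.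
Qed.

Lemma sum_inv_exp_le2 (F : realFieldType) (s n : nat) : (2 <= s)%N ->
  \sum_(1 <= m < n.+1) m%:R ^- s <= 2 :> F.
Proof.
move=> s2; case: n => [|n]; first by rewrite big_geq.
apply: (@le_trans _ _ (\sum_(1 <= m < n.+2) m%:R ^- 2)).
  by apply: ler_sum_nat => m /andP[m0 _]; exact: inv_exp_le_inv_sqr.
rewrite big_ltn // expr1n invr1 [leRHS]mulr2n lerD2l.
by rewrite (le_trans (@sum_inv_sqr_le F 1 n.+1 isT)) // invr1 lerBlDr lerDl invr_ge0.
Qed.

Lemma totient_ratio_ge0 (F : realFieldType) (s m : nat) : 0 <= totient_ratio F s m.
Proof. by rewrite divr_ge0 ?exprn_ge0. Qed.

Lemma totient_ratio_le (F : realFieldType) (s m : nat) :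
  totient_ratio F s.+1 m <= m%:R ^- s.
Proof.
have [->|m0] := posnP m; first by rewrite /totient_ratio mul0r invr_ge0 exprn_ge0.
have mF : 0 < m%:R :> F by rewrite ltr0n.
rewrite /totient_ratio exprS invfM mulrA ler_piMl ?invr_ge0 ?exprn_ge0 ?(ltW mF) //.
by rewrite ler_pdivrMr // mul1r ler_nat totient_leq.
Qed.

Lemma Dirichlet_conv_totient (F : realFieldType) (s m : nat) : (0 < m)%N ->
  Dirichlet_conv (totient_ratio F s.+1) (fun e => e%:R ^- s.+1) m = m%:R ^- s.
Proof.
move=> m0; have mF : m%:R != 0 :> F by rewrite pnatr_eq0 gtn_eqF.
transitivity (\sum_(1 <= d < m.+1 | (d %| m)%N) (totient d)%:R * m%:R ^- s.+1 : F).
  rewrite /Dirichlet_conv big_nat_cond [RHS]big_nat_cond.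
  apply: eq_bigr => d /andP[_ /divnK dm].
  by rewrite /totient_ratio -mulrA -invfM -exprMn -natrM mulnC dm.
rewrite -mulr_suml -natr_sum (_ : \sum_(1 <= d < m.+1 | d %| m) totient d = m)%N.
  by rewrite exprS invfM mulVKf.
rewrite -[RHS](sum_totient_dvd m) -(big_mkord (fun d => d %| m)%N totient).
by rewrite [RHS]big_mkcond [RHS]big_ltn // dvd0n gtn_eqF //= add0n -big_mkcond.
Qed.

Definition Series1 (f : nat -> R) : R := Series (fun k => f (k + 1)%N).

Definition nonneg_summable (f : nat -> R) : Prop :=
  (forall m, (0 < m)%N -> 0 <= f m) /\ exists B, forall n, \sum_(1 <= m < n.+1) f m <= B.

Lemma sum_n_succE (f : nat -> R) (n : nat) :
  sum_n (fun k => f (k + 1)%N) n = \sum_(1 <= m < n.+2) f m.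
Proof.
rewrite big_add1 /=; elim: n => [|n IH]; first by rewrite sum_O big_nat1.
by rewrite sum_Sn IH [RHS]big_nat_recr //= addn1.
Qed.

Lemma ler_sum_nat_widen (F : numDomainType) (f : nat -> F) (n p : nat) :
  (forall m, (0 < m)%N -> 0 <= f m) ->
  (n <= p)%N -> \sum_(1 <= m < n.+1) f m <= \sum_(1 <= m < p.+1) f m.
Proof.
move=> f0 np; rewrite [leRHS](@big_cat_nat _ _ _ n.+1) //= lerDl big_nat.
by apply: sumr_ge0 => m /andP[nm _]; apply: f0; apply: leq_trans nm.
Qed.

Lemma is_series_Series1 (f : nat -> R) : nonneg_summable f ->
  is_series (fun k => f (k + 1)%N) (Series1 f).
Proof.
move=> [f0 [B fB]]; have [|n|l fl] := ex_finite_lim_seq_incr (sum_n (fun k => f (k + 1)%N)) B.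
- by move=> n; apply/RleP; rewrite !sum_n_succE ler_sum_nat_widen.
- by apply/RleP; rewrite sum_n_succE.
by rewrite /Series1 (is_series_unique _ l fl).
Qed.

Lemma sum_le_Series1 (f : nat -> R) (n : nat) : nonneg_summable f ->
  \sum_(1 <= m < n.+1) f m <= Series1 f.
Proof.
move=> sf; have [f0 _] := sf; apply: (le_trans (ler_sum_nat_widen f0 (leqnSn n))).
rewrite -sum_n_succE; apply/RleP.
apply: is_lim_seq_incr_compare; first exact: is_series_Series1.
by move=> p; apply/RleP; rewrite !sum_n_succE ler_sum_nat_widen.
Qed.

Lemma Series1_le (f : nat -> R) (B : R) : nonneg_summable f ->
  (forall n, \sum_(1 <= m < n.+1) f m <= B) -> Series1 f <= B.
Proof.
move=> sf fB; apply/RleP.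
apply: (is_lim_seq_le _ (fun=> B) (Series1 f) B _ (is_series_Series1 sf) (is_lim_seq_const B)).
by move=> n; apply/RleP; rewrite sum_n_succE.
Qed.

Lemma Series1_ge0 (f : nat -> R) : nonneg_summable f -> 0 <= Series1 f.
Proof. by move=> sf; have := sum_le_Series1 0 sf; rewrite big_geq. Qed.

Lemma nonneg_summableZ (c : R) (f : nat -> R) : 0 <= c -> nonneg_summable f ->
  nonneg_summable (fun m => c * f m).
Proof.
move=> c0 [f0 [B fB]]; split=> [m m0|]; first by rewrite mulr_ge0 ?f0.
by exists (c * B) => n; rewrite -mulr_sumr ler_wpM2l.
Qed.

Lemma Series1_mull (c : R) (f : nat -> R) : Series1 (fun m => c * f m) = c * Series1 f.
Proof. exact: Series_scal_l. Qed.

Section DirichletSeries.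

Variables f g : nat -> R.
Hypotheses (f_summable : nonneg_summable f) (g_summable : nonneg_summable g).

Lemma sum_Dirichlet_conv_le (X : nat) :
  \sum_(1 <= m < X.+1) Dirichlet_conv f g m <= Series1 f * Series1 g.
Proof.
have [f0 _] := f_summable; rewrite sum_Dirichlet_conv.
apply: le_trans (ler_wpM2r (Series1_ge0 g_summable) (sum_le_Series1 X f_summable)).
rewrite mulr_suml; apply: ler_sum_nat => d /andP[d0 _].
by rewrite ler_wpM2l ?sum_le_Series1 // f0.
Qed.

Lemma nonneg_summable_Dirichlet_conv : nonneg_summable (Dirichlet_conv f g).
Proof.
have [[f0 _] [g0 _]] := (f_summable, g_summable); split=> [m m0|].
  rewrite /Dirichlet_conv big_nat_cond sumr_ge0 // => d /andP[/andP[d0 _] dm].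
  by rewrite mulr_ge0 ?f0 ?g0 // divn_gt0 // dvdn_leq.
by exists (Series1 f * Series1 g); exact: sum_Dirichlet_conv_le.
Qed.

(* A product [d * e] with [d <= Y] and [e <= Z] is at most [Y * Z]. *)
Lemma mul_sum_le_Dirichlet_conv (Y Z : nat) :
  (\sum_(1 <= d < Y.+1) f d) * (\sum_(1 <= e < Z.+1) g e) <= Series1 (Dirichlet_conv f g).
Proof.
have [[f0 _] [g0 _]] := (f_summable, g_summable).
apply: le_trans (sum_le_Series1 (Y * Z) nonneg_summable_Dirichlet_conv).
rewrite sum_Dirichlet_conv; have [->|Z0] := posnP Z.
  by rewrite muln0 [in X in _ * X]big_geq // mulr0 big_geq.
have term_ge0 d : (0 < d)%N -> 0 <= f d * \sum_(1 <= e < (Y * Z %/ d).+1) g e.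
  by move=> d0; rewrite mulr_ge0 ?f0 // big_nat sumr_ge0 // => e /andP[e0 _]; exact: g0.
apply: le_trans (ler_sum_nat_widen term_ge0 (leq_pmulr Y Z0)).
rewrite mulr_suml; apply: ler_sum_nat => d /andP[d0 dY].
by rewrite ler_wpM2l ?f0 // ler_sum_nat_widen // leq_divRL // mulnC leq_mul2r -ltnS dY orbT.
Qed.

Lemma Series1_Dirichlet_conv : Series1 (Dirichlet_conv f g) = Series1 f * Series1 g.
Proof.
have [f0 _] := f_summable; apply/le_anti/andP; split.
  exact: Series1_le nonneg_summable_Dirichlet_conv sum_Dirichlet_conv_le.
rewrite mulrC -Series1_mull; apply: Series1_le => [|Y].
  exact: nonneg_summableZ (Series1_ge0 g_summable) f_summable.
rewrite -mulr_sumr mulrC -Series1_mull; apply: Series1_le => [|Z].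
  apply: nonneg_summableZ g_summable; rewrite big_nat sumr_ge0 // => d /andP[d0 _].
  exact: f0.
by rewrite -mulr_sumr mul_sum_le_Dirichlet_conv.
Qed.

End DirichletSeries.

Lemma zetaE (s : nat) : zeta s = Series1 (fun m => m%:R ^- s).
Proof. by apply: Series_ext => k; rewrite RinvE RpowE INRE. Qed.

Lemma nonneg_summable_inv_exp (s : nat) : (2 <= s)%N -> nonneg_summable (fun m => m%:R ^- s).
Proof.
move=> s2; split=> [m _|]; first by rewrite invr_ge0 exprn_ge0.
by exists 2 => n; exact: sum_inv_exp_le2.
Qed.

Lemma sum_totient_ratio_le2 (F : realFieldType) (s n : nat) : (2 <= s)%N ->
  \sum_(1 <= m < n.+1) totient_ratio F s.+1 m <= 2.
Proof.
move=> s2; apply: le_trans (sum_inv_exp_le2 F n s2).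
by apply: ler_sum_nat => m _; exact: totient_ratio_le.
Qed.

Lemma nonneg_summable_totient_ratio (s : nat) : (2 <= s)%N ->
  nonneg_summable (totient_ratio R s.+1).
Proof.
move=> s2; split=> [m _|]; first exact: totient_ratio_ge0.
by exists 2 => n; exact: sum_totient_ratio_le2.
Qed.

Lemma Series1_eq (f g : nat -> R) : (forall m, (0 < m)%N -> f m = g m) -> Series1 f = Series1 g.
Proof. by move=> fg; apply: Series_ext => k; rewrite fg // addn1. Qed.

Lemma Series1_totient_ratio (s : nat) : (2 <= s)%N ->
  Series1 (totient_ratio R s.+1) * zeta s.+1 = zeta s.
Proof.
move=> s2; rewrite !zetaE -Series1_Dirichlet_conv; last 2 first.
- exact: nonneg_summable_totient_ratio.
- exact: nonneg_summable_inv_exp (leqW s2).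
by apply: Series1_eq => m m0; exact: Dirichlet_conv_totient.
Qed.

Lemma zeta_ge1 (s : nat) : (2 <= s)%N -> 1 <= zeta s.
Proof.
move=> s2; rewrite zetaE; have := sum_le_Series1 1 (nonneg_summable_inv_exp s2).
by rewrite big_nat1 expr1n invr1.
Qed.

Lemma KconstE : Kconst = 10 / 3 * Series1 (totient_ratio R 3).
Proof.
have zeta3 : zeta 3 != 0 by rewrite gt_eqF // (lt_le_trans ltr01) // zeta_ge1.
rewrite /Kconst -(@Series1_totient_ratio 2) // !RealsE /=.
by field.
Qed.

Lemma Series1_totient_ratio_tail (s n : nat) : (2 <= s)%N -> (0 < n)%N ->
  Series1 (totient_ratio R s.+1) <= \sum_(1 <= m < n.+1) totient_ratio R s.+1 m + n%:R^-1.
Proof.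
move=> s2 n0; apply: Series1_le => [|p]; first exact: nonneg_summable_totient_ratio.
have [pn|/ltnW np] := leqP p n.
  rewrite (le_trans (ler_sum_nat_widen (fun m _ => totient_ratio_ge0 R s.+1 m) pn)) //.
  by rewrite lerDl invr_ge0.
rewrite (@big_cat_nat _ _ _ n.+1) //= lerD2l.
apply: (@le_trans _ _ (\sum_(n.+1 <= m < p.+1) m%:R ^- 2)).
  apply: ler_sum_nat => m /andP[nm _]; apply: le_trans (totient_ratio_le R s m) _.
  by apply: inv_exp_le_inv_sqr => //; apply: leq_trans nm.
by rewrite (le_trans (@sum_inv_sqr_le R n p _)) ?n0 // lerBlDr lerDl invr_ge0.
Qed.

Lemma sum_inv_le_ln (n : nat) : (0 < n)%N -> \sum_(1 <= m < n.+1) m%:R^-1 <= 1 + ln n%:R.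
Proof.
move=> n0; rewrite big_ltn // invr1 lerD2l big_add1 /=.
have -> : ln n%:R = \sum_(1 <= m < n) (ln m.+1%:R - ln m%:R).
  by rewrite (telescope_sumr (fun m => ln m%:R)) // (ln_1 : ln 1%:R = 0) subr0.
apply: ler_sum_nat => m /andP[m0 _].
have mF : 0 < m%:R :> R by rewrite ltr0n.
have x0 : 0 < m%:R / m.+1%:R :> R by rewrite divr_gt0 ?ltr0n.
have := exp_ineq1_le (ln (m%:R / m.+1%:R)); rewrite exp_ln; last exact/RltP.
rewrite ln_div; [|exact/RltP|exact/RltP/ltr0n].
move/RleP; rewrite !RealsE /= (_ : m%:R / m.+1%:R = 1 - m.+1%:R^-1).
  by rewrite lerD2l -opprB lerN2.
by rewrite -natr1; field; lra.
Qed.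

Lemma ln_natr_le (m n : nat) : (0 < m <= n)%N -> ln m%:R <= ln n%:R.
Proof.
move=> /andP[m0 mn]; apply/RleP; apply: ln_le; first by apply/RltP; rewrite ltr0n.
by apply/RleP; rewrite ler_nat.
Qed.

Lemma half_le_ln2 : 1 / 2 <= ln 2%:R.
Proof. by have /RltP/ltW := ln_lt_2; rewrite !RealsE /= mul1r. Qed.

Lemma sum_inv_le_4ln (N : nat) : (1 < N)%N ->
  \sum_(1 <= m < (2 * N).+1) m%:R^-1 <= 4 * ln N%:R.
Proof.
move=> N1; have ln2 := half_le_ln2; have lnN : ln 2%:R <= ln N%:R by exact: ln_natr_le.
apply: le_trans (sum_inv_le_ln _) _; first by lia.
rewrite natrM (_ : ln (2%:R * N%:R)%R = ln 2%:R + ln N%:R); first by lra.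
by apply: ln_mult; apply/RltP; rewrite ?ltr0n // ltnW.
Qed.

(** * The asymptotic formula *)

Lemma exprS_add1_sub_bounds (F : realFieldType) (x : F) (k : nat) : 0 <= x ->
  0 <= (x + 1) ^+ k.+1 - x ^+ k.+1 <= k.+1%:R * (x + 1) ^+ k.
Proof.
move=> x0; have x1 : x <= x + 1 by rewrite lerDl.
rewrite subr_ge0 lerXn2r ?nnegrE ?addr_ge0 //= subrXX addrAC subrr add0r mul1r.
rewrite mulr_natl -[k.+1 in leRHS]card_ord -sumr_const; apply: ler_sum => i _.
apply: (@le_trans _ _ ((x + 1) ^+ (k - i) * (x + 1) ^+ i)).
  by rewrite ler_wpM2l ?exprn_ge0 ?addr_ge0 // lerXn2r ?nnegrE ?addr_ge0.
by rewrite -exprD subnK // -ltnS.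
Qed.

Lemma mul_exprS_shift_le (F : realFieldType) (A Z x : F) (k : nat) :
  1 <= x -> 0 <= Z <= 2 -> 0 <= Z - A <= x^-1 ->
  `|A * (x + 1) ^+ k.+1 - Z * x ^+ k.+1| <= 2 * k.+1%:R * (x + 1) ^+ k.
Proof.
move=> x1 /andP[Z0 Z2] /andP[ZA0 ZAx]; have x0 : 0 <= x by lra.
have /andP[diff0 diff_le] := exprS_add1_sub_bounds k x0.
have y0 : 0 <= x + 1 by rewrite addr_ge0.
have yk0 : 0 <= (x + 1) ^+ k by rewrite exprn_ge0.
have shift_part : 0 <= Z * ((x + 1) ^+ k.+1 - x ^+ k.+1) <= 2 * (k.+1%:R * (x + 1) ^+ k).
  by rewrite mulr_ge0 //= ler_pM.
have /andP[zy0 zy2] : 0 <= (Z - A) * (x + 1) <= 2.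
  by rewrite mulr_ge0 //= (le_trans (ler_wpM2r y0 ZAx)) // mulrC ler_pdivrMr; lra.
have tail_part : 0 <= (Z - A) * (x + 1) ^+ k.+1 <= 2 * (k.+1%:R * (x + 1) ^+ k).
  rewrite exprS mulrA mulr_ge0 //= (le_trans (ler_wpM2r yk0 zy2)) // ler_wpM2l //.
  by rewrite ler_peMl // ler1n.
rewrite (_ : A * _ - _ =
  Z * ((x + 1) ^+ k.+1 - x ^+ k.+1) - (Z - A) * (x + 1) ^+ k.+1); last by ring.
move: shift_part tail_part; rewrite mulrA ler_norml => /andP[s0 s1] /andP[t0 t1].
by rewrite lerBlDr lerBrDr; apply/andP; split; lra.
Qed.

Lemma main_term_transfer (F : realFieldType) (c A Z x L : F) :
  1 <= x -> 0 <= Z <= 2 -> 0 <= Z - A <= x^-1 -> 1 / 2 <= L ->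
  `|c - 10 / 3 * A * (x + 1) ^+ 5| <= 33 * (x + 1) ^+ 4 * (4 * L) ->
  `|c - 10 / 3 * Z * x ^+ 5| <= 200 * (x + 1) ^+ 4 * L.
Proof.
move=> x1 Z02 ZA L2 count; have := mul_exprS_shift_le 4 x1 Z02 ZA.
have yL : (x + 1) ^+ 4 <= (x + 1) ^+ 4 * (2 * L).
  by rewrite ler_peMr ?exprn_ge0 //; lra.
have -> : c - 10 / 3 * Z * x ^+ 5 = c - 10 / 3 * A * (x + 1) ^+ 5 +
  10 / 3 * (A * (x + 1) ^+ 5 - Z * x ^+ 5) by ring.
move: count; set b := c - _; set e := A * _ - _.
move: ((x + 1) ^+ 4) yL => y yL; clearbody b e.
by rewrite !ler_norml; lra.
Qed.

Lemma Cfrak2_asymptotics (N : nat) : (1 < N)%N ->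
  `|(Cfrak 2 N)%:R - Kconst * (2 * N)%:R ^+ 5| <= 16200 * N%:R ^+ 4 * ln N%:R.
Proof.
move=> N1; pose A := \sum_(1 <= m < (2 * N).+1) totient_ratio R 3 m.
pose x : R := (2 * N)%:R; have xE : x = 2 * N%:R by rewrite /x natrM.
have summable : nonneg_summable (totient_ratio R 3) by exact: nonneg_summable_totient_ratio.
have N2 : 2 <= N%:R :> R by rewrite ler_nat.
have ln_ge : 1 / 2 <= ln N%:R by apply: le_trans half_le_ln2 _; exact: ln_natr_le.
have y4 : (x + 1) ^+ 4 <= 81 * N%:R ^+ 4.
  rewrite (_ : 81 * N%:R ^+ 4 = (3 * N%:R) ^+ 4); last by ring.
  by rewrite lerXn2r ?nnegrE; lra.
have count : `|(Cfrak 2 N)%:R - 10 / 3 * A * (x + 1) ^+ 5| <= 33 * (x + 1) ^+ 4 * (4 * ln N%:R).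
  have := @Cfrak2_estimate R N (ltnW N1); rewrite natrD !addn1 => /le_trans; apply.
  by rewrite ler_wpM2l ?sum_inv_le_4ln // mulr_ge0 // exprn_ge0 // addr_ge0.
apply: (@le_trans _ _ (200 * (x + 1) ^+ 4 * ln N%:R)); last first.
  rewrite (_ : 16200 * N%:R ^+ 4 * ln N%:R = 200 * (81 * N%:R ^+ 4) * ln N%:R); last by ring.
  by rewrite ler_wpM2r ?ler_wpM2l //; lra.
rewrite KconstE; apply: (main_term_transfer (A := A) (x := x)) => //.
- by rewrite xE; lra.
- by rewrite Series1_ge0 //=; apply: Series1_le => // n; exact: sum_totient_ratio_le2.
- by rewrite subr_ge0 sum_le_Series1 //= lerBlDl; apply: Series1_totient_ratio_tail; lia.
Qed.

Local Delimit Scope R_scope with coqR.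

Lemma Cfrak2_asymptotics_Rle (N : nat) : (1 < N)%N ->
  (Rabs (INR (Cfrak 2 N) - Kconst * INR (2 * N) ^ 5) <= 16200 * INR N ^ 4 * ln (INR N))%coqR.
Proof. by move=> N1; apply/RleP; rewrite !RealsE; exact: Cfrak2_asymptotics. Qed.

End CommutingMatrices.

From Corelib Require Import ssreflect.

Theorem theorem1p2 :
  exists C : R, forall N : nat, (1 < N)%nat ->
    (Rabs (INR (Cfrak 2 N) - Kconst * (INR (2 * N)) ^ 5)
       <= C * (INR N) ^ 4 * ln (INR N))%R.
Proof.
exists 16200%R => N /(ssrbool.introT ssrnat.ltP).
exact: CommutingMatrices.Cfrak2_asymptotics_Rle.
Qed.
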